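(* Let $n\geq 0$ and let $X$ and $Y$ be spaces. If $f:X\to Y$ and $g:Y\to X$ are homotopy inverses, then for any ordinal $\kappa$, the maps $f$ and $g$ restrict to maps $f_{\kappa}:\mathbf{w}_n^{\kappa}(X)\to \mathbf{w}_n^{\kappa}(Y)$ and $g_{\kappa}:\mathbf{w}_n^{\kappa}(Y)\to \mathbf{w}_n^{\kappa}(X)$, and these restrictions are homotopy inverses.
   Context: All topological spaces are Hausdorff and ''map'' means continuous function. $S^n$ is the unit $n$-sphere with basepoint $s_0=(1,0,\dots,0)$. A map $f:S^n\to X$ is essential if it is not null-homotopic. A sequence of maps $f_k:S^n\to X$, $k\in\mathbb{N}$, converges to $x\in X$ if for every neighborhood $U$ of $x$ there is $K$ with $\mathrm{Im}(f_k)\subseteq U$ for all $k\geq K$. The $\pi_n$-wild set $\mathbf{w}_n(X)$ is the subspace of all points $x\in X$ for which there is a sequence of essential based maps $f_k:(S^n,s_0)\to (X,x)$ converging to $x$. Iterated wild sets: $\mathbf{w}_n^0(X)=X$, $\mathbf{w}_n^{\kappa+1}(X)=\mathbf{w}_n(\mathbf{w}_n^{\kappa}(X))$ (with the subspace topology on $\mathbf{w}_n^{\kappa}(X)$), and $\mathbf{w}_n^{\kappa}(X)=\bigcap_{\mu<\kappa}\mathbf{w}_n^{\mu}(X)$ for limit ordinals $\kappa$. Homotopies are free (unbased). *)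

(* Defs.v *)
From HB Require Import structures.
From mathcomp Require Import all_boot all_order all_algebra.
From mathcomp Require Import all_classical all_reals all_analysis.
Set Implicit Arguments. Unset Strict Implicit. Unset Printing Implicit Defensive.
Import Order.TTheory GRing.Theory Num.Theory.
Import numFieldNormedType.Exports.
Local Open Scope classical_set_scope.
Local Open Scope ring_scope.

(* Subspaces [A : set T] are used as spaces through the coercion
   [set_type A = {x | x \in A}], which carries the initial topology of the
   inclusion [set_val]. *)

Definition unit_interval (R : realType) : set R := `[0, 1].
Arguments unit_interval : clear implicits.

Lemma unit_interval0 (R : realType) : (0 : R) \in unit_interval R.
Proof. by rewrite inE /unit_interval /= in_itv /= lexx ler01. Qed.

Lemma unit_interval1 (R : realType) : (1 : R) \in unit_interval R.
Proof. by rewrite inE /unit_interval /= in_itv /= lexx ler01. Qed.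

Definition I0 (R : realType) : unit_interval R := SigSub (unit_interval0 R).
Definition I1 (R : realType) : unit_interval R := SigSub (unit_interval1 R).

(* The norm of 'rV[R]_n.+1 in the library is the sup norm, so the Euclidean
   sphere is given by its equation; both norms induce the same topology. *)
Definition sphere (R : realType) (n : nat) : set 'rV[R]_n.+1 :=
  [set v : 'rV[R]_n.+1 | \sum_(i < n.+1) v ord0 i ^+ 2 = 1].
Arguments sphere : clear implicits.

Lemma sphere_e0 (R : realType) (n : nat) :
  (delta_mx ord0 ord0 : 'rV[R]_n.+1) \in sphere R n.
Proof.
rewrite inE /sphere /= (bigD1 ord0) //= mxE !eqxx expr1n big1 ?addr0 // => i.
by move=> /negPf i0; rewrite mxE i0 andbF expr0n.
Qed.

Definition sphere_base (R : realType) (n : nat) : sphere R n :=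
  SigSub (sphere_e0 R n).

Section homotopy.
Variable R : realType.

(* free homotopy *)
Definition homotopic (T U : topologicalType) (f g : T -> U) : Prop :=
  exists H : T * unit_interval R -> U,
    [/\ continuous H,
        forall x, H (x, I0 R) = f x &
        forall x, H (x, I1 R) = g x].

Definition homotopy_inverses (T U : topologicalType) (f : T -> U) (g : U -> T)
    : Prop :=
  [/\ continuous f, continuous g,
      homotopic (g \o f) idfun & homotopic (f \o g) idfun].

Definition null_homotopic (T U : topologicalType) (f : T -> U) : Prop :=
  exists y : U, homotopic f (cst y).

Definition essential (T U : topologicalType) (f : T -> U) : Prop :=
  continuous f /\ ~ null_homotopic f.

Definition maps_converge_to (S T : topologicalType) (f : nat -> S -> T) (x : T)
    : Prop :=
  forall U : set T, nbhs x U ->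
    exists K : nat, forall k, (K <= k)%N -> range (f k) `<=` U.

Definition wild_set (n : nat) (T : topologicalType) : set T :=
  [set x | exists f : nat -> sphere R n -> T,
    (forall k, essential (f k) /\ f k (sphere_base R n) = x) /\
    maps_converge_to f x].

End homotopy.
Arguments homotopic R {T U} f g.
Arguments homotopy_inverses R {T U} f g.
Arguments null_homotopic R {T U} f.
Arguments essential R {T U} f.
Arguments wild_set R n T : clear implicits.

(* An ordinal is represented as a position [k] in a well-ordered type [I]: it
   is the order type of the initial segment [j < k].  Every ordinal arises this
   way (take [I] of order type at least its successor). *)
Definition is_succ {d : Order.disp_t} {I : orderType d} (j k : I) : Prop :=
  (j < k)%O /\ forall i : I, (j < i)%O -> (k <= i)%O.

Section iterated_wild_set.
Variables (R : realType) (n : nat) (T : topologicalType).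
Context {d : Order.disp_t} {I : orderType d}.
Variable wfI : well_founded (fun i j : I => (i < j)%O).

(* For [k] the least element of [I], the second case reads [w^0 = T]. *)
Definition iter_wild_step (k : I) (W : forall j : I, (j < k)%O -> set T)
    : set T :=
  [set x |
    (exists (j : I) (jk : (j < k)%O), is_succ j k /\
       (set_val @` (wild_set R n _ : set (set_type (W j jk)))) x) \/
    ((forall j : I, ~ is_succ j k) /\
       forall (j : I) (jk : (j < k)%O), W j jk x)].

Definition iter_wild : I -> set T :=
  Fix wfI (fun=> set T) iter_wild_step.

Lemma iter_wildE (k : I) :
  iter_wild k = iter_wild_step (fun j (_ : (j < k)%O) => iter_wild j).
Proof.
rewrite /iter_wild Fix_eq // => {}k V W VW.
by congr iter_wild_step; apply: functional_extensionality_dep => j;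
  apply/funext => jk.
Qed.

Lemma iter_wild0 (k : I) : (forall j : I, ~ (j < k)%O) -> iter_wild k = setT.
Proof.
move=> k0; rewrite iter_wildE; apply/seteqP; split => // x _; right.
by split=> [j [/k0]|j /k0].
Qed.

Lemma iter_wildS (j k : I) : is_succ j k ->
  iter_wild k = set_val @` (wild_set R n _ : set (set_type (iter_wild j))).
Proof.
move=> sjk; rewrite iter_wildE; apply/seteqP; split => x; last first.
  by move=> wx; left; exists j, sjk.1.
case=> [[i [ik [sik]]]|[/(_ j)//]].
suff -> : i = j by [].
apply/le_anti/andP; split; rewrite leNgt; apply/negP.
  by move=> /sjk.2; rewrite leNgt ik.
by move=> /sik.2; rewrite leNgt sjk.1.
Qed.

Lemma iter_wild_lim (k : I) : (forall j : I, ~ is_succ j k) ->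
  iter_wild k = \bigcap_(j in [set j : I | (j < k)%O]) iter_wild j.
Proof.
move=> lk; rewrite iter_wildE; apply/seteqP; split => x.
  by case=> [[j [_ [/lk[]]]]|[_ h] j jk //]; exact: h.
by move=> h; right; split=> // j jk; exact: h.
Qed.

End iterated_wild_set.
Arguments iter_wild R n T {d I} wfI k.

(* Main.v *)
Require Import Defs.
From mathcomp Require Import all_boot all_order all_algebra.
From mathcomp Require Import all_classical all_reals all_analysis.
Import numFieldNormedType.Exports.

(** Homotopy equivalences preserve wildness because they reflect
    null-homotopies.  If [psi \o phi] is homotopic to the identity, then [a] is
    homotopic to [psi \o (phi \o a)], so [phi \o a] is essential whenever [a] is
    (lemma [essential_comp]); and [phi] carries a sequence converging to [x] to
    one converging to [phi x].  Hence [phi] maps wild points to wild points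
    (lemma [wild_set_dominated]).

    This alone does not make the restrictions homotopy inverses: the homotopies
    must restrict to the wild sets as well, and the induction on the ordinal
    needs them at every stage.  But each stage [H_t] of a homotopy [H] ending at
    the identity is itself homotopic to the identity, by running [H] from time
    [t] to time 1.  So [H_t] also maps wild points to wild points, and all of [H]
    stays in the wild set (lemma [wild_set_homotopy]).

    Fix therefore [f], [g] and homotopies [H] from [g \o f] and [G] from
    [f \o g] to the identities.  The property that all four preserve a pair of
    subspaces [A] of [X] and [B] of [Y] passes to the wild sets of [A] and [B]
    (lemma [preserved_wild_set]), since restricted to [A] and [B] the four maps
    are again data of the same kind; it passes trivially to intersections.
    Well-founded induction gives it for all iterated wild sets. *)

Import Order.TTheory GRing.Theory Num.Theory.
Local Open Scope classical_set_scope.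
Local Open Scope ring_scope.

(** * Continuous maps into products and subspaces *)

Lemma continuous_pair {T U V : topologicalType} {f : T -> U} {g : T -> V} :
  continuous f -> continuous g -> continuous (fun x => (f x, g x)).
Proof. by move=> cf cg x; apply: cvg_pair; [exact: cf|exact: cg]. Qed.

Lemma continuous_set_val {T : topologicalType} {A : set T} :
  continuous (set_val : A -> T).
Proof. exact: initial_continuous. Qed.

Lemma continuous_into_subspace {S T : topologicalType} {A : set T} {f : S -> A} :
  continuous (fun x => set_val (f x)) -> continuous f.
Proof. exact: continuous_comp_initial. Qed.

Lemma continuous_composition {S T U : topologicalType} {f : S -> T} {g : T -> U} :
  continuous f -> continuous g -> continuous (g \o f).
Proof. by move=> cf cg x; apply: continuous_comp; [exact: cf|exact: cg]. Qed.

(** * Free homotopies *)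

Section homotopies.
Context {R : realType}.

(** Times of homotopies are produced by real formulas; retracting the line onto
    the interval turns them into points of the interval, and formulas that leave
    it at the ends then give homotopies that pause there. *)
Lemma clamp_subproof (r : R) : Num.max 0 (Num.min 1 r) \in unit_interval R.
Proof.
by rewrite inE /unit_interval /= in_itv /= le_max lexx ge_max ler01 ge_min lexx.
Qed.

Definition clamp (r : R) : unit_interval R := SigSub (clamp_subproof r).

Lemma clamp_le0 (r : R) : r <= 0 -> clamp r = I0 R.
Proof.
move=> r0; apply/val_inj => /=; rewrite min_r ?max_l //.
by rewrite (le_trans r0) ?ler01.
Qed.

Lemma clamp_ge1 (r : R) : 1 <= r -> clamp r = I1 R.
Proof. by move=> r1; apply/val_inj => /=; rewrite min_l ?max_r ?ler01. Qed.

Lemma clampK (t : unit_interval R) : clamp (set_val t) = t.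
Proof.
apply/val_inj => /=; have := set_valP t.
by rewrite /unit_interval /= in_itv /= => /andP[t0 t1]; rewrite min_r ?max_r.
Qed.

Lemma continuous_clamp : continuous clamp.
Proof.
apply: continuous_into_subspace => r.
apply: (@continuous_max R R (cst 0) (cst 1 \min id)); first exact: cvg_cst.
by apply: continuous_min; [exact: cvg_cst|exact: cvg_id].
Qed.

Lemma continuous_reparam {S T U : topologicalType}
    {H : T * unit_interval R -> U} {f : S -> T} {c : S -> R} :
  continuous H -> continuous f -> continuous c ->
  continuous (fun z => H (f z, clamp (c z))).
Proof.
move=> cH cf cc; apply: (continuous_composition _ cH).
exact: continuous_pair cf (continuous_composition cc continuous_clamp).
Qed.

Lemma continuous_time {T : topologicalType} :
  continuous (fun z : T * unit_interval R => set_val z.2).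
Proof. exact: continuous_composition (fun=> cvg_snd) continuous_set_val. Qed.

Lemma homotopic_sym {T U : topologicalType} {f g : T -> U} :
  homotopic R f g -> homotopic R g f.
Proof.
move=> [H [cH H0 H1]].
exists (fun z => H (z.1, clamp (1 - set_val z.2))); split => [|x|x] /=.
- apply: continuous_reparam => //; first exact: (fun=> cvg_fst).
  by move=> z; apply: cvgB; [exact: cvg_cst|exact: continuous_time].
- by rewrite subr0 clamp_ge1.
- by rewrite subrr clamp_le0.
Qed.

(** The concatenation runs [H] at double speed on the first half and [G] on the
    second.  Thanks to the retraction both halves are defined and continuous on
    all of [T * [0, 1]], so that the pasting lemma applies directly. *)
Lemma homotopic_trans {T U : topologicalType} {f g h : T -> U} :
  homotopic R f g -> homotopic R g h -> homotopic R f h.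
Proof.
move=> [H [cH H0 H1]] [G [cG G0 G1]].
pose t (z : T * unit_interval R) : R := set_val z.2.
have ct : continuous t by exact: continuous_time.
pose H' z := H (z.1, clamp (t z + t z)).
pose G' z := G (z.1, clamp (t z + t z - 1)).
have cH' : continuous H'.
  apply: continuous_reparam => //; first exact: (fun=> cvg_fst).
  by move=> z; apply: cvgD; exact: ct.
have cG' : continuous G'.
  apply: continuous_reparam => //; first exact: (fun=> cvg_fst).
  by move=> z; apply: cvgB; [apply: cvgD; exact: ct|exact: cvg_cst].
have half1 : 2^-1 + 2^-1 = 1 :> R by rewrite [RHS]splitr div1r.
pose K z := if t z <= 2^-1 then H' z else G' z.
exists K; split => [|x|x].
- pose A := [set z | t z <= 2^-1]; pose B := [set z | 2^-1 <= t z].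
  (* at time 1/2 both halves are at [g], as [H] has ended and [G] starts *)
  have KG z : 2^-1 <= t z -> K z = G' z.
    rewrite /K; case: ifPn => // t_le t_ge.
    have -> : H' z = g z.1 by rewrite /H' clamp_ge1 // -half1 lerD.
    by rewrite /G' clamp_le0 // subr_le0 -half1 lerD.
  have KA : {within A, continuous K}.
    apply: (@subspace_eq_continuous _ A _ H'); last exact: continuous_subspaceT.
    by move=> z /[!inE] zA; rewrite /from_subspace /K zA.
  have KB : {within B, continuous K}.
    apply: (@subspace_eq_continuous _ B _ G'); last exact: continuous_subspaceT.
    by move=> z /[!inE] zB; rewrite /from_subspace KG.
  have clA : closed A by apply: (closed_comp _ (@closed_le R _)) => z _; exact: ct.
  have clB : closed B by apply: (closed_comp _ (@closed_ge R _)) => z _; exact: ct.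
  have AB : A `|` B = setT.
    apply/seteqP; split => // z _.
    by case/orP: (le_total (t z) 2^-1); [left|right].
  apply/continuous_subspace_setT; rewrite -AB.
  exact: withinU_continuous clA clB KA KB.
- by rewrite /K /H' /t /= invr_ge0 ler0n addr0 clamp_le0.
- rewrite /K /G' /t /= addrK clamp_ge1 // G1.
  by rewrite leNgt invf_lt1 ?ltr0n // ltr1n.
Qed.

Lemma homotopic_comp {S T U V : topologicalType} {f g : T -> U}
    {a : S -> T} {b : U -> V} :
  continuous a -> continuous b -> homotopic R f g ->
  homotopic R (b \o f \o a) (b \o g \o a).
Proof.
move=> ca cb [H [cH H0 H1]].
exists (fun z => b (H (a z.1, z.2))); split => [|x|x] /=; rewrite ?H0 ?H1 //.
apply: (continuous_composition _ cb); apply: (continuous_composition _ cH).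
apply: continuous_pair; last exact: (fun=> cvg_snd).
exact: continuous_composition (fun=> cvg_fst) ca.
Qed.

(** * Invariance of the wild set *)

(** A null-homotopy of [phi \o a] composed with [psi] is one of
    [psi \o phi \o a], which is homotopic to [a]. *)
Lemma essential_comp {S T U : topologicalType} {a : S -> T}
    {phi : T -> U} {psi : U -> T} :
  continuous phi -> continuous psi -> homotopic R (psi \o phi) idfun ->
  essential R a -> essential R (phi \o a).
Proof.
move=> cphi cpsi psiphi [ca a_ess]; split; first exact: continuous_composition.
move=> [u phia_u]; apply: a_ess; exists (psi u).
apply: (homotopic_trans (g := psi \o phi \o a)).
  by apply: homotopic_sym; exact: (homotopic_comp (b := idfun) ca (fun=> cvg_id) psiphi).
exact: (homotopic_comp (a := idfun) (fun=> cvg_id) cpsi phia_u).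
Qed.

(** A left homotopy inverse of [phi] suffices, so that the lemma applies both to
    homotopy equivalences and to self-maps homotopic to the identity. *)
Lemma wild_set_dominated {n : nat} {T U : topologicalType}
    {phi : T -> U} {psi : U -> T} {x : T} :
  continuous phi -> continuous psi -> homotopic R (psi \o phi) idfun ->
  wild_set R n T x -> wild_set R n U (phi x).
Proof.
move=> cphi cpsi psiphi [a [a_ess ax]]; exists (fun k => phi \o a k); split.
  move=> k; have [ess base] := a_ess k; split; last by rewrite /= base.
  exact: essential_comp cphi cpsi psiphi ess.
move=> V /cphi /ax[K aK]; exists K => k Kk _ [s _ <-].
by apply: (aK k Kk); exists s.
Qed.

(** The homotopy waits at time [t] until time [t], then follows [H] up to time 1:
    at time [s] it is [H] at time [max s t]. *)
Lemma homotopic_stage_id {T : topologicalType} {H : T * unit_interval R -> T}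
    (t : unit_interval R) :
  continuous H -> (forall x, H (x, I1 R) = x) ->
  homotopic R (fun x => H (x, t)) idfun.
Proof.
move=> cH H1.
exists (fun z => H (z.1, clamp (Num.max (set_val z.2) (set_val t)))).
split => [|x|x] /=.
- apply: continuous_reparam => //; first exact: (fun=> cvg_fst).
  move=> z; apply: (@continuous_max _ _ (fun z => set_val z.2) (cst _)).
    exact: continuous_time.
  exact: cvg_cst.
- rewrite max_r ?clampK //; have := set_valP t.
  by rewrite /unit_interval /= in_itv /= => /andP[].
- by rewrite clamp_ge1 ?H1 // le_max lexx.
Qed.

Lemma wild_set_homotopy {n : nat} {T : topologicalType}
    {H : T * unit_interval R -> T} {x : T} (t : unit_interval R) :
  continuous H -> (forall x, H (x, I1 R) = x) ->
  wild_set R n T x -> wild_set R n T (H (x, t)).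
Proof.
move=> cH H1; apply: (wild_set_dominated (phi := fun y => H (y, t)) (psi := idfun)).
- apply: (continuous_composition _ cH); apply: continuous_pair => //.
    by move=> ?; exact: cvg_id.
  by move=> ?; exact: cvg_cst.
- by move=> ?; exact: cvg_id.
- exact: homotopic_stage_id.
Qed.

End homotopies.

(** * Restriction of maps and homotopies to subspaces *)

Section restriction.
Context {R : realType}.

Definition restrict_map {T U : Type} {A : set T} {B : set U} {f : T -> U}
    (fAB : forall x, A x -> B (f x)) (x : A) : B :=
  SigSub (mem_set (fAB _ (set_valP x))).

Definition restrict_homotopy {T : topologicalType} {A : set T}
    {H : T * unit_interval R -> T} (HA : forall x t, A x -> A (H (x, t)))
    (z : A * unit_interval R) : A :=
  SigSub (mem_set (HA _ z.2 (set_valP z.1))).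

Lemma continuous_restrict_map {T U : topologicalType} {A : set T} {B : set U}
    {f : T -> U} (fAB : forall x, A x -> B (f x)) :
  continuous f -> continuous (restrict_map fAB).
Proof.
move=> cf; apply: continuous_into_subspace.
exact: continuous_composition continuous_set_val cf.
Qed.

Lemma continuous_restrict_homotopy {T : topologicalType} {A : set T}
    {H : T * unit_interval R -> T} (HA : forall x t, A x -> A (H (x, t))) :
  continuous H -> continuous (restrict_homotopy HA).
Proof.
move=> cH; apply: continuous_into_subspace.
apply: (@continuous_composition _ _ _
  (fun z : A * unit_interval R => (set_val z.1, z.2)) _ _ cH).
apply: continuous_pair; last exact: (fun=> cvg_snd).
exact: continuous_composition (fun=> cvg_fst) continuous_set_val.
Qed.

Lemma homotopic_restrict {T U : topologicalType} {A : set T} {B : set U}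
    {f : T -> U} {g : U -> T} {H : T * unit_interval R -> T}
    (fAB : forall x, A x -> B (f x)) (gBA : forall y, B y -> A (g y))
    (HA : forall x t, A x -> A (H (x, t))) :
  continuous H -> (forall x, H (x, I0 R) = g (f x)) ->
  (forall x, H (x, I1 R) = x) ->
  homotopic R (restrict_map gBA \o restrict_map fAB) idfun.
Proof.
move=> cH H0 H1; exists (restrict_homotopy HA).
split; first exact: continuous_restrict_homotopy.
- by move=> x; apply/val_inj; rewrite /= H0.
- by move=> x; apply/val_inj; rewrite /= H1.
Qed.

End restriction.

(** * Iterated wild sets *)

Section iteration.
Context {R : realType} {X Y : topologicalType}.
Variables (f : X -> Y) (g : Y -> X).
Variables (H : X * unit_interval R -> X) (G : Y * unit_interval R -> Y).
Hypotheses (cf : continuous f) (cg : continuous g).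
Hypotheses (cH : continuous H) (H0 : forall x, H (x, I0 R) = g (f x))
  (H1 : forall x, H (x, I1 R) = x).
Hypotheses (cG : continuous G) (G0 : forall y, G (y, I0 R) = f (g y))
  (G1 : forall y, G (y, I1 R) = y).

(** The induction hypothesis.  It includes the homotopies: without them the
    restrictions of [f] and [g] to [A] and [B] would not be known to be homotopy
    inverses, and nothing could be said of the wild sets of [A] and [B]. *)
Record preserved (A : set X) (B : set Y) : Prop := Preserved {
  preserved_f : forall x, A x -> B (f x);
  preserved_g : forall y, B y -> A (g y);
  preserved_H : forall x t, A x -> A (H (x, t));
  preserved_G : forall y t, B y -> B (G (y, t)) }.

(** The restrictions of [f] and [g] to [A] and [B] are homotopy inverses through
    the restrictions of [H] and [G], so the invariance lemmas for the wild set
    apply to the spaces [A] and [B]. *)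
Lemma preserved_wild_set {n : nat} {A : set X} {B : set Y} :
  preserved A B ->
  preserved (set_val @` (wild_set R n _ : set (set_type A)))
            (set_val @` (wild_set R n _ : set (set_type B))).
Proof.
move=> [fAB gBA HA GB].
have cfk := continuous_restrict_map fAB cf.
have cgk := continuous_restrict_map gBA cg.
split.
- move=> _ [x wx <-]; exists (restrict_map fAB x) => //.
  exact: wild_set_dominated cfk cgk (homotopic_restrict fAB gBA HA cH H0 H1) wx.
- move=> _ [y wy <-]; exists (restrict_map gBA y) => //.
  exact: wild_set_dominated cgk cfk (homotopic_restrict gBA fAB GB cG G0 G1) wy.
- move=> _ t [x wx <-]; exists (restrict_homotopy HA (x, t)) => //.
  apply: wild_set_homotopy wx; first exact: continuous_restrict_homotopy.
  by move=> z; apply/val_inj; rewrite /= H1.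
- move=> _ t [y wy <-]; exists (restrict_homotopy GB (y, t)) => //.
  apply: wild_set_homotopy wy; first exact: continuous_restrict_homotopy.
  by move=> z; apply/val_inj; rewrite /= G1.
Qed.

Lemma preserved_iter_wild (n : nat) (d : Order.disp_t) (I : orderType d)
    (wfI : well_founded (fun i j : I => (i < j)%O)) (k : I) :
  preserved (iter_wild R n X wfI k) (iter_wild R n Y wfI k).
Proof.
elim/(well_founded_ind wfI): k => k IH.
have [[j sjk]|no_pred] := pselect (exists j, is_succ j k).
  by rewrite !(@iter_wildS R n _ d I wfI j k sjk); exact: preserved_wild_set (IH j sjk.1).
(* [k] is least or a limit; an empty intersection is the whole space *)
have lim_k j : ~ is_succ j k by move=> sjk; apply: no_pred; exists j.
rewrite !(@iter_wild_lim R n _ d I wfI k lim_k); split=> [x Ax|y By|x t Ax|y t By] j jk.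
- exact: preserved_f _ _ (IH j jk) _ (Ax j jk).
- exact: preserved_g _ _ (IH j jk) _ (By j jk).
- exact: preserved_H _ _ (IH j jk) _ _ (Ax j jk).
- exact: preserved_G _ _ (IH j jk) _ _ (By j jk).
Qed.

End iteration.

Theorem theorem3p15 (R : realType) (n : nat) (X Y : topologicalType)
    (hX : hausdorff_space X) (hY : hausdorff_space Y)
    (f : X -> Y) (g : Y -> X) (hfg : homotopy_inverses R f g)
    (d : Order.disp_t) (I : orderType d)
    (wfI : well_founded (fun i j : I => (i < j)%O)) (k : I) :
  exists (fk : set_type (iter_wild R n X wfI k) ->
               set_type (iter_wild R n Y wfI k))
         (gk : set_type (iter_wild R n Y wfI k) ->
               set_type (iter_wild R n X wfI k)),
    [/\ forall x, set_val (fk x) = f (set_val x),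
        forall y, set_val (gk y) = g (set_val y) &
        homotopy_inverses R fk gk].
Proof.
have [cf cg [H [cH H0 H1]] [G [cG G0 G1]]] := hfg.
have [fk gk Hk Gk] := preserved_iter_wild f g H G cf cg cH H0 H1 cG G0 G1 n _ _ wfI k.
exists (restrict_map fk), (restrict_map gk); split=> //; split.
- exact: continuous_restrict_map.
- exact: continuous_restrict_map.
- exact: homotopic_restrict fk gk Hk cH H0 H1.
- exact: homotopic_restrict gk fk Gk cG G0 G1.
Qed.
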